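(* For every $\varepsilon>0$ and every sufficiently large $n\in\mathbb{N}$ (depending on $\varepsilon$), $$R(Q_n,Q_n)\le n^2-(1-\varepsilon)\,n\log n.$$
   Context: $\log$ denotes the logarithm with base $2$. For posets $P$ and $Q$, an (induced) copy of $P$ in $Q$ is the image of an injective map $\phi\colon P\to Q$ such that for all $X,Y\in P$, $X\le_P Y$ if and only if $\phi(X)\le_Q\phi(Y)$. $Q_n$ denotes the Boolean lattice of dimension $n$, i.e. the poset of all subsets of an $n$-element set ordered by inclusion. A blue/red coloring of a poset assigns to each of its elements the color blue or red; a subposet is blue (red) if all its elements are blue (red). The poset Ramsey number $R(P,Q)$ is the least $N\in\mathbb{N}$ such that every blue/red coloring of the elements of $Q_N$ contains a blue induced copy of $P$ or a red induced copy of $Q$. *)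

(* Defs.v *)
From HB Require Import structures.
From mathcomp Require Import all_boot all_order all_algebra.
From mathcomp Require Import reals exp.

Set Implicit Arguments.
Unset Strict Implicit.
Unset Printing Implicit Defensive.

Import Order.TTheory Order.DefaultSetSubsetOrder.
Local Open Scope order_scope.

(* DefaultSetSubsetOrder makes inclusion the canonical order of {set T}. *)
Definition boolean_lattice (n : nat) : finPOrderType _ := {set 'I_n}.

Section InducedCopy.
Context {dP dQ : Order.disp_t}.
Variables (P : finPOrderType dP) (Q : finPOrderType dQ).

Definition is_embedding (phi : {ffun P -> Q}) : bool :=
  injectiveb phi && [forall X, forall Y, (X <= Y) == (phi X <= phi Y)].

Definition is_copy (S : {set Q}) : bool :=
  [exists phi : {ffun P -> Q}, is_embedding phi && (S == phi @: P)].

(* A coloring c is boolean: true is blue, false is red. *)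
Definition has_copy_of_color (c : {ffun Q -> bool}) (b : bool) : bool :=
  [exists S : {set Q}, is_copy S && [forall X in S, c X == b]].

End InducedCopy.

Definition ramsey_arrow {dP dQ : Order.disp_t}
    (P : finPOrderType dP) (Q : finPOrderType dQ) (N : nat) : bool :=
  [forall c : {ffun boolean_lattice N -> bool},
     has_copy_of_color P c true || has_copy_of_color Q c false].

Lemma has_copy_of_colorP {dP d : Order.disp_t}
    (P : finPOrderType dP) (T : finPOrderType d)
    (c : {ffun T -> bool}) (b : bool) (f : P -> T) :
  {mono f : x y / x <= y} -> (forall x, c (f x) = b) ->
  has_copy_of_color P c b.
Proof.
move=> fmono fcol; apply/existsP; exists [set f x | x : P]; apply/andP; split.
  apply/existsP; exists [ffun x => f x]; apply/andP; split.
    apply/andP; split.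
      apply/injectiveP => x y; rewrite !ffunE => fxy.
      by apply: le_anti; rewrite -!fmono fxy lexx.
    by apply/forallP => x; apply/forallP => y; rewrite !ffunE fmono.
  by apply/eqP/eq_imset => x; rewrite ffunE.
by apply/forallP => y; apply/implyP => /imsetP[x _ ->]; apply/eqP.
Qed.

Section RamseyNumber.
Context {dP dQ : Order.disp_t}.
Variables (P : finPOrderType dP) (Q : finPOrderType dQ).

(* The ground set consists of P together with layers, indexed by 'I_#|P|.+1,
   each of which is a copy of Q.  For x in P, the sets whose trace on P is the
   principal ideal of x, that contain all the layers of index smaller than the
   size of this ideal and that avoid all those of larger index, include a copy
   of Q.  If no such copy is red, then choosing a blue element from each of
   them yields a blue copy of P. *)
Lemma ramsey_arrow_exists : exists N, ramsey_arrow P Q N.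
Proof.
pose E : finType := (P + 'I_#|P|.+1 * Q)%type.
exists #|E|; apply/forallP => c.
pose ideal (x : P) := [set y | y <= x].
pose code (A : {set E}) : boolean_lattice #|E| := enum_rank @: A.
have codeE A B : (code A <= code B) = (A \subset B).
  apply/idP/idP; last exact: imsetS.
  move=> sAB; apply/subsetP => e eA.
  have /(subsetP sAB)/imsetP[e' e'B /enum_rank_inj ->//] :
    enum_rank e \in enum_rank @: A by exact: imset_f.
pose blob (x : P) (q : Q) : {set E} :=
  [set e : E | match (e : P + 'I_#|P|.+1 * Q) with
     | inl y => y <= x
     | inr (i, r) =>
         (i < #|ideal x|)%N || ((i == #|ideal x| :> nat) && (r <= q))
     end].
have [/existsP[x /forallP redx]|] :=
  boolP [exists x, forall q, c (code (blob x q)) == false].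
  apply/orP; right; apply: (has_copy_of_colorP (f := fun q => code (blob x q)))
    => [q r|q]; last exact/eqP.
  rewrite codeE; apply/subsetP/idP => [sqr|qr [y|[i s]]]; rewrite ?inE //.
    have lt : (#|ideal x| < #|P|.+1)%N by rewrite ltnS max_card.
    by have := sqr (inr (Ordinal lt, q)); rewrite !inE /= ltnn eqxx lexx; apply.
  by case/orP => [->//|/andP[-> /le_trans->]//]; rewrite orbT.
rewrite negb_exists => /forallP nored.
have blue x : {q | c (code (blob x q))}.
  apply: sigW; have := nored x; rewrite negb_forall => /existsP[q].
  by rewrite eqbF_neg negbK; exists q.
apply/orP; left; apply: (has_copy_of_colorP
  (f := fun x => code (blob x (sval (blue x))))) => [x y|x]; last exact: (svalP (blue x)).
rewrite codeE; apply/subsetP/idP => [sxy|].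
  by have := sxy (inl x); rewrite !inE lexx; apply.
rewrite le_eqVlt => /orP[/eqP->//|lt_xy] [z|[i s]]; rewrite !inE.
  by move=> /le_trans->//; exact: ltW.
have ltI : (#|ideal x| < #|ideal y|)%N.
  apply: proper_card; apply/properP; split.
    by apply/subsetP => z; rewrite !inE => /le_trans->//; exact: ltW.
  by exists y; rewrite !inE ?lexx // lt_geF.
by case/orP => [/ltn_trans->//|/andP[/eqP-> _]]; rewrite ltI.
Qed.

Definition poset_ramsey : nat := ex_minn ramsey_arrow_exists.

End RamseyNumber.

Definition log2 (R : realType) (x : R) : R := (ln x / ln 2)%R.

(* Main.v *)
Require Import Defs.
From mathcomp Require Import all_boot all_order all_algebra.
From mathcomp Require Import reals exp.
From mathcomp Require Import zify lra.

(* In the standard layered construction of a copy of Q_n, the set A has trace A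
   on an n-set and each of the n + 1 levels costs a new n-set.  The lowest r
   levels can be had for a single set W of about n + r 2^r elements: going up
   the levels, give each A with fewer than r elements the union of what its
   proper subsets received, plus fewer than r elements of W making it blue.  If
   this never gets stuck, the lowest r levels of a blue Q_n fit into W.  If it
   gets stuck at A, then at most r 2^r elements of W have been used below A, and
   adding to that set fewer than r of the n remaining ones always yields red, so
   the lowest r levels of a red Q_n are already there.  Either way only
   n + 1 - r levels have to be paid for, and r 2^r <= n allows r to be about
   log n. *)

(** * Injections and traces *)

Lemma injection_in_set (T : finType) (A : {set T}) (n : nat) :
  (n <= #|A|)%N -> exists y : 'I_n -> T, injective y /\ forall i, y i \in A.
Proof.
case/card_geqP=> s [us sz sA].
have sztup : size s == n by rewrite sz.
exists (tnth (Tuple sztup)); split; first exact/tuple_uniqP.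
by move=> i; apply: sA; apply: (mem_tnth i (Tuple sztup)).
Qed.

(** [U] and [V] miss the range of [y], so [A] can be read off as the trace of [y @: A :|: U]. The
    embeddings below are checked this way. *)
Lemma subset_imset_disjoint (n : nat) (T : finType) (y : 'I_n -> T)
    (A B : {set 'I_n}) (U V : {set T}) :
  injective y -> (forall i, y i \notin U) -> (forall i, y i \notin V) ->
  (y @: A :|: U \subset y @: B :|: V) = (A \subset B) && (U \subset y @: B :|: V).
Proof.
move=> inj_y yU yV; rewrite subUset; congr (_ && _); apply/idP/idP.
  move=> sAB; apply/subsetP => i iA.
  have /(subsetP sAB) : y i \in y @: A by exact: imset_f.
  by rewrite inE (negPf (yV i)) orbF mem_imset.
by move=> sAB; apply: subset_trans (imsetS _ sAB) (subsetUl _ _).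
Qed.

(** * Layered extension and greedy choice of the low levels *)

Section Coloring.
Context {n N : nat}.
Variable c : {ffun boolean_lattice N -> bool}.

Lemma has_copy_of_color_sets (b : bool) (f : {set 'I_n} -> {set 'I_N}) :
  {mono f : A B / A \subset B} -> (forall A, c (f A) = b) ->
  has_copy_of_color (boolean_lattice n) c b.
Proof.
move=> fmono fcol.
by apply: (@has_copy_of_colorP _ _ (boolean_lattice n) (boolean_lattice N) c b f).
Qed.

(* Each step assigns the next level of the lattice to a fresh set of [n]
   elements: the [n]-dimensional blob over it either meets color [b] or is a
   copy of color [~~ b]. *)
Lemma extend_partial_copy (b : bool) (y : 'I_n -> 'I_N) (k d : nat)
    (z : {set 'I_n} -> {set 'I_N}) (G F : {set 'I_N}) :
  injective y -> (n < k + d)%N ->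
  (forall A : {set 'I_n}, (#|A| < k)%N -> c (y @: A :|: z A) = b) ->
  (forall A : {set 'I_n}, (#|A| < k)%N -> z A \subset G) ->
  (forall A B : {set 'I_n}, A \subset B -> (#|B| < k)%N -> z A \subset z B) ->
  (forall i, y i \notin G) -> (forall i, y i \notin F) ->
  [disjoint F & G] -> (d * n <= #|F|)%N ->
  has_copy_of_color (boolean_lattice n) c b
  || has_copy_of_color (boolean_lattice n) c (~~ b).
Proof.
move=> inj_y; elim: d k z G F => [|d IHd] k z G F.
  rewrite addn0 => ltnk zcol zG zmono yG _ _ _; apply/orP; left.
  have lt_k (A : {set 'I_n}) : (#|A| < k)%N.
    by apply: leq_ltn_trans ltnk; rewrite -[leqRHS]card_ord max_card.
  have yz A i : y i \notin z A by apply: contra (yG i); exact/subsetP/zG.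
  apply: (@has_copy_of_color_sets _ (fun A => y @: A :|: z A)) => [A B|A].
    rewrite subset_imset_disjoint //; case sAB: (A \subset B) => //=.
    by apply: subset_trans (zmono A B sAB (lt_k B)) (subsetUr _ _).
  exact: zcol.
move=> ltnk zcol zG zmono yG yF dFG cardF.
have [x [inj_x xF]] : exists x : 'I_n -> 'I_N, injective x /\ forall i, x i \in F.
  by apply: injection_in_set; apply: leq_trans cardF; rewrite mulSn leq_addr.
set X := x @: [set: 'I_n].
have sXF : X \subset F by apply/subsetP => _ /imsetP[i _ ->].
have cardX : #|X| = n by rewrite card_imset // cardsT card_ord.
have yX i : y i \notin X by apply: contra (yF i); exact/subsetP.
have [/existsP[A /forallP blobA]|] :=
  boolP [exists A : {set 'I_n}, forall Z : {set 'I_n},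
           c (x @: Z :|: (y @: A :|: G)) == ~~ b].
  apply/orP; right.
  apply: (@has_copy_of_color_sets _ (fun Z => x @: Z :|: (y @: A :|: G))) => [Z Z'|Z].
    have xU i : x i \notin y @: A :|: G.
      rewrite inE (disjointFr dFG (xF i)) orbF.
      by apply/imsetP => -[j _ xy]; have := yF j; rewrite -xy xF.
    by rewrite subset_imset_disjoint // subsetUr andbT.
  exact/eqP.
rewrite negb_exists => /forallP blob.
have {}blob (A : {set 'I_n}) : {Z : {set 'I_n} | c (x @: Z :|: (y @: A :|: G)) == b}.
  apply: sigW; have := blob A; rewrite negb_forall => /existsP[Z cZ].
  by exists Z; move: cZ; case: (c _); case: (b).
(* Only sets of size [k] get their final value here; larger ones are overwritten at later steps.
   Including all of [G] puts every earlier value below the new ones. *)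
pose z' (A : {set 'I_n}) := if (#|A| < k)%N then z A else G :|: x @: sval (blob A).
apply: (IHd k.+1 z' (G :|: X) (F :\: X)).
- by rewrite addSnnS.
- move=> A _; rewrite /z'; case: ifP => [/zcol//|_].
  by rewrite setUA setUC; apply/eqP/(svalP (blob A)).
- move=> A _; rewrite /z'; case: ifP => [/zG zAG|_].
    exact: subset_trans zAG (subsetUl _ _).
  by rewrite setUS // imsetS // subsetT.
- move=> A B sAB ltB; rewrite /z'.
  have [ltBk|leBk] := ltnP #|B| k.
    by rewrite (leq_ltn_trans (subset_leq_card sAB) ltBk) zmono.
  case: ifP => [/zG zAG|/negbT]; first exact: subset_trans zAG (subsetUl _ _).
  rewrite -leqNgt => leAk; have /eqP -> // : A == B.
  by rewrite eqEcard sAB (leq_trans _ leAk).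
- by move=> i; rewrite inE negb_or yG yX.
- by move=> i; rewrite inE negb_and yF orbT.
- rewrite disjoints_subset; apply/subsetP => i; rewrite !inE => /andP[iX iF].
  by rewrite negb_or iX andbT (disjointFr dFG iF).
- by rewrite cardsD (setIidPr sXF) cardX; move: cardF; rewrite mulSn; lia.
Qed.

(* [s B] collects the elements added when [B] is treated; indexing the additions
   by subsets makes the images monotone and bounds [U] by [r * 2 ^ r], where a
   level-by-level estimate would only give a factorial. *)
Lemma greedy_low_levels (r k : nat) (y : 'I_n -> 'I_N) (W : {set 'I_N}) :
  (k <= r)%N ->
  (exists s : {set 'I_n} -> {set 'I_N},
     [/\ forall A, s A \subset W, forall A, (#|s A| < r)%N \/ s A = set0
       & forall A : {set 'I_n}, (#|A| < k)%N ->
           c (y @: A :|: \bigcup_(B in powerset A) s B) = true]) \/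
  (exists A : {set 'I_n}, exists U : {set 'I_N},
     [/\ (#|A| < r)%N, (#|U| <= r * 2 ^ r)%N, U \subset W
       & forall S : {set 'I_N}, S \subset W -> (#|S| < r)%N ->
           c (y @: A :|: U :|: S) = false]).
Proof.
elim: k => [_|k IHk ltkr].
  (* For [r = 0] the empty set does not have fewer than [r] elements, hence the alternative
     [s A = set0]. *)
  left; exists (fun=> set0); split=> // [A|A]; first exact: sub0set.
  by right.
have [[s [sW cards scol]]|?] := IHk (ltnW ltkr); last by right.
pose U (A : {set 'I_n}) := \bigcup_(B in powerset A :\ A) s B.
have sUW A : U A \subset W by apply/bigcupsP => B _; exact: sW.
have [/existsP[A /andP[/eqP cardA /forallP stuck]]|] :=
  boolP [exists A : {set 'I_n}, (#|A| == k) &&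
    [forall S : {set 'I_N}, (S \subset W) ==> (#|S| < r)%N
       ==> ~~ c (y @: A :|: U A :|: S)]].
  right; exists A, (U A); split=> //; first by rewrite cardA.
    apply: (@leq_trans (\sum_(B in powerset A :\ A) r)).
      apply: (big_ind2 (fun (V : {set 'I_N}) m => #|V| <= m)%N) => [|V m V' m' hV hV'|B _].
      - by rewrite cards0.
      - by apply: leq_trans (leq_add hV hV'); rewrite cardsU leq_subr.
      - by case: (cards B) => [/ltnW//|->]; rewrite cards0.
    rewrite sum_nat_const mulnC leq_mul2l; apply/orP; right.
    apply: leq_trans (subset_leq_card (subsetDl _ _)) _.
    by rewrite card_powerset cardA leq_exp2l // ltnW.
  move=> S sSW ltS; apply/negbTE.
  by have /implyP/(_ sSW)/implyP/(_ ltS) := stuck S.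
rewrite negb_exists => /forallP free; left.
have {}free (A : {set 'I_n}) : {S : {set 'I_N} | [&& S \subset W, (#|S| < r)%N
    & (#|A| == k) ==> c (y @: A :|: U A :|: S)]}.
  apply: sigW; have := free A; rewrite negb_and => /orP[/negPf->|].
    by exists set0; rewrite sub0set cards0 (leq_ltn_trans _ ltkr).
  rewrite negb_forall => /existsP[S]; rewrite !negb_imply andbT => /and3P[sSW ltS cS].
  by exists S; rewrite sSW ltS cS implybT.
pose s' (A : {set 'I_n}) := if #|A| == k then sval (free A) else s A.
exists s'; split=> [A|A|A].
- by rewrite /s'; case: ifP => // _; case/and3P: (svalP (free A)).
- by rewrite /s'; case: ifP => // _; left; case/and3P: (svalP (free A)).
have low (B : {set 'I_n}) : (#|B| < k)%N -> s' B = s B.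
  by move=> ltB; rewrite /s' ifN // neq_ltn ltB.
rewrite ltnS leq_eqVlt => /orP[/eqP cardA|ltAk]; last first.
  rewrite -[RHS](scol A ltAk); congr (c (_ :|: _)).
  apply: eq_bigr => B; rewrite powersetE => /subset_leq_card leBA.
  by rewrite low // (leq_ltn_trans leBA).
have /and3P[_ _ /implyP/(_ (introT eqP cardA)) <-] := svalP (free A).
(* The term at [A] is the new choice; the other terms come from smaller sets, where [s'] agrees with
   [s]. *)
rewrite (big_setD1 A) ?powersetE //= -setUA [_ :|: sval _]setUC.
rewrite {1}/s' ifT ?cardA //; congr (c (_ :|: (_ :|: _))).
apply: eq_bigr => B; rewrite !inE => /andP[neqBA sBA].
by rewrite low // -cardA proper_card // properEneq neqBA.
Qed.

End Coloring.

(** * Size of the ground set *)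

(** The count is [n] for the trace, [n + r * 2 ^ r + r] for [W], and [n] for each of the [n.+1 - r]
    remaining levels. *)
Lemma ramsey_arrow_diagonal (n r N : nat) :
  (r <= n)%N -> (3 * n + r * 2 ^ r + r + (n - r) * n <= N)%N ->
  ramsey_arrow (boolean_lattice n) (boolean_lattice n) N.
Proof.
move=> le_rn leN; apply/forallP => c.
pose w := (n + r * 2 ^ r + r)%N.
have cardT : #|[set: 'I_N]| = N by rewrite cardsT card_ord.
have [|v [inj_v _]] := @injection_in_set _ [set: 'I_N] (n + w).
  by rewrite cardT; apply: leq_trans leN; rewrite /w; move: ((n - r) * n)%N => ?; lia.
pose y (i : 'I_n) := v (lshift w i).
pose W := [set v (rshift n j) | j : 'I_w].
have inj_y : injective y by move=> i j /inj_v/lshift_inj.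
have yW i : y i \notin W.
  by apply/imsetP => -[j _ /inj_v/eqP]; rewrite eq_lrshift.
have cardW : #|W| = w.
  by rewrite card_imset ?card_ord // => i j /inj_v/rshift_inj.
pose Y := [set y i | i : 'I_n].
have cardY : #|Y| = n by rewrite card_imset // card_ord.
have dim : ((n.+1 - r) * n <= N - n - w)%N by rewrite subSn // mulSn /w; lia.
have [[s [sW _ scol]]|[A [U [ltA cardU sUW red]]]] :=
    greedy_low_levels c r r y W (leqnn r).
  apply: (@extend_partial_copy _ _ c true y r (n.+1 - r)
    (fun A => \bigcup_(B in powerset A) s B) W (~: (Y :|: W))) => //.
  - by rewrite subnKC // leqW.
  - by move=> A _; apply/bigcupsP.
  - move=> A B sAB _; apply/bigcupsP => C; rewrite powersetE => sCA.
    by apply: bigcup_sup; rewrite powersetE (subset_trans sCA).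
  - by move=> i; rewrite !inE negbK imset_f.
  - by rewrite disjoints_subset setCS subsetUr.
  - rewrite cardsCs setCK card_ord; apply: leq_trans dim _.
    rewrite -subnDA leq_sub2l // -cardY -cardW cardsU leq_subr //.
(* Stuck case: the trace moves to [n] elements of [W :\: U] and [y @: A :|: U] becomes the constant
   remainder, so the levels below [r] are red. *)
have [|x [inj_x xWU]] := @injection_in_set _ (W :\: U) n.
  by rewrite cardsD (setIidPr sUW) cardW /w; lia.
have xW i : x i \in W by have := xWU i; rewrite inE => /andP[].
have xU i : x i \notin U by have := xWU i; rewrite inE => /andP[].
pose D := [set x i | i : 'I_n]; pose G := y @: A :|: U.
have cardD : #|D| = n by rewrite card_imset // card_ord.
have cardG : (#|G| <= r + r * 2 ^ r)%N.
  rewrite cardsU (leq_trans (leq_subr _ _)) // leq_add //.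
  by rewrite card_imset // ltnW.
rewrite orbC; apply: (@extend_partial_copy _ _ c false x r (n.+1 - r)
  (fun=> G) G (~: (D :|: G))) => //.
- by rewrite subnKC // leqW.
- move=> B ltB; rewrite setUC; apply: red.
    by apply/subsetP => _ /imsetP[i _ ->].
  by rewrite card_imset.
- move=> i; rewrite inE negb_or xU andbT; apply/imsetP => -[j _ xy].
  by have := yW j; rewrite -xy xW.
- by move=> i; rewrite !inE negbK imset_f.
- by rewrite disjoints_subset setCS subsetUr.
- rewrite cardsCs setCK card_ord; apply: leq_trans dim _.
  rewrite -subnDA leq_sub2l // cardsU cardD (leq_trans (leq_subr _ _)) //.
  by rewrite leq_add2l /w; lia.
Qed.

Lemma poset_ramsey_diagonal_le (n r : nat) :
  (r <= n)%N -> (r * 2 ^ r <= n)%N ->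
  (poset_ramsey (boolean_lattice n) (boolean_lattice n) <= 5 * n + (n - r) * n)%N.
Proof.
move=> le_rn le_n; rewrite /poset_ramsey; case: ex_minnP => N _; apply.
by apply: (@ramsey_arrow_diagonal n r) => //; lia.
Qed.

(** * Asymptotics in [n] *)

Lemma sqr_le_exp2 (l : nat) : (10 <= l)%N -> ((l + 7) ^ 2 <= 2 ^ l)%N.
Proof.
elim: l => // l IHl; rewrite leq_eqVlt => /orP[/eqP <-//|lel].
have := IHl lel; rewrite (expnS 2 l); nia.
Qed.

Local Open Scope ring_scope.
Import GRing.Theory Num.Theory Order.Theory.

Lemma trunc_log_le_log2 (R : realType) (n : nat) :
  (0 < n)%N -> (trunc_log 2 n)%:R <= log2 n%:R :> R.
Proof.
move=> n_gt0; have ln2 : 0 < ln 2 :> R by rewrite ln_gt0 // ltr1n.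
rewrite /log2 ler_pdivlMr // mulr_natl -lnXn // -natrX ler_ln ?posrE ?ltr0n ?expn_gt0 //.
by rewrite ler_nat trunc_logP.
Qed.

Lemma log2_lt_trunc_logS (R : realType) (n : nat) :
  (0 < n)%N -> log2 n%:R < (trunc_log 2 n).+1%:R :> R.
Proof.
move=> n_gt0; have ln2 : 0 < ln 2 :> R by rewrite ln_gt0 // ltr1n.
rewrite /log2 ltr_pdivrMr // mulr_natl -lnXn // -natrX ltr_ln ?posrE ?ltr0n ?expn_gt0 //.
by rewrite ltr_nat trunc_log_ltn.
Qed.

Theorem corollary2 (R : realType) (eps : R) :
  0 < eps ->
  exists n0 : nat, forall n : nat, (n0 <= n)%N ->
    (poset_ramsey (boolean_lattice n) (boolean_lattice n))%:R
      <= n%:R ^+ 2 - (1 - eps) * n%:R * log2 n%:R :> R.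
Proof.
(* The [10] serves [sqr_le_exp2], the other term gives [1 <= eps * m]. The threshold [2 ^ 2 ^ m]
   makes the iterated logarithm [l] at least [m]. *)
move=> eps_gt0; pose m := maxn 10 (Num.truncn eps^-1).+1.
have m_eps : 1 <= eps * m%:R.
  rewrite -ler_pdivrMl // mulr1; apply: ltW.
  apply: lt_le_trans (truncnS_gt _) _.
  by rewrite ler_nat leq_maxr.
exists (2 ^ 2 ^ m)%N => n le_n0n.
have n_gt0 : (0 < n)%N by apply: leq_trans le_n0n; rewrite expn_gt0.
set L := trunc_log 2 n; set l := trunc_log 2 L.
have leL : (2 ^ m <= L)%N by apply: trunc_log_max.
have L_gt0 : (0 < L)%N by apply: leq_trans leL; rewrite expn_gt0.
have lel : (m <= l)%N by apply: trunc_log_max.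
have l_ge10 : (10 <= l)%N by apply: leq_trans lel; rewrite leq_maxl.
have le2lL : (2 ^ l <= L)%N by apply: trunc_logP.
have ltL : (L < 2 ^ l.+1)%N by apply: trunc_log_ltn.
have le2Ln : (2 ^ L <= n)%N by apply: trunc_logP.
have ltlL : (l < L)%N by apply: leq_trans le2lL; apply: ltn_expl.
have ltLn : (L < n)%N by apply: leq_trans le2Ln; apply: ltn_expl.
(* [2 ^ (L - l.+1) * L <= 2 ^ L], as [L < 2 ^ l.+1]. *)
pose r := (L - l.+1)%N.
have le_rn : (r <= n)%N by rewrite /r; lia.
have r2r : (r * 2 ^ r <= n)%N.
  apply: leq_trans le2Ln; rewrite -[in leqRHS](subnKC ltlL) expnD leq_mul2r.
  by apply/orP; right; apply: leq_trans (ltnW ltL); rewrite /r leq_subr.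
have := poset_ramsey_diagonal_le n r le_rn r2r.
rewrite -(ler_nat R) => /le_trans; apply.
(* The [7] adds up the [5] of [5 * n], the [1] in the choice of [r], and the rounding of [log2 n] to
   [L]. The bound holds as [m <= l + 7] and [(l + 7) ^ 2 <= 2 ^ l <= L]. *)
have slack : (l + 7)%:R <= eps * L%:R.
  apply: (@le_trans _ _ (eps * ((l + 7) ^ 2)%:R)).
    rewrite natrX expr2 mulrA ler_peMl ?ler0n //.
    apply: le_trans m_eps _; rewrite ler_pM2l // ler_nat.
    exact: leq_trans lel (leq_addr _ _).
  by rewrite ler_pM2l // ler_nat; apply: leq_trans le2lL; apply: sqr_le_exp2.
have logL := @trunc_log_le_log2 R n n_gt0.
have logS := @log2_lt_trunc_logS R n n_gt0.
rewrite -/L in logL logS.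
have rE : r%:R = L%:R - (l%:R + 1) :> R by rewrite natrB // -natr1.
have -> : (5 * n + (n - r) * n)%:R = n%:R * (5 + n%:R - r%:R) :> R.
  by rewrite natrD !natrM natrB // -mulrDl mulrC addrA.
have -> : n%:R ^+ 2 - (1 - eps) * n%:R * log2 n%:R
    = n%:R * (n%:R - (1 - eps) * log2 n%:R) :> R.
  by rewrite mulrBr -expr2 [in RHS]mulrCA [in RHS]mulrA.
rewrite ler_pM2l ?ltr0n //.
have : eps * L%:R <= eps * log2 n%:R by rewrite ler_pM2l.
move: slack logS; rewrite natrD -natr1 rE mulrBl mul1r; lra.
Qed.
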